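(* Suppose $k=k(n)\le n/2$ and $t=t(n)$ is a positive integer with $t\big/\sqrt[3]{k/\log^2 n}\to 0$ as $n\to\infty$. Then the number of $2$-$(n,k,2t+1)$-codes is at most $2^{H(n,k,2t+1)(1+o(1))}$, where $o(1)\to0$ as $n\to\infty$.
   Context: Let $\mathcal Y$ be the set of unordered pairs $(A_1,A_2)$ of disjoint $k$-subsets of $[n]$. The transportation distance between $(A_1,A_2),(B_1,B_2)\in\mathcal Y$ is $d((A_1,A_2),(B_1,B_2))=\min\{|A_1\setminus B_1|+|A_2\setminus B_2|,\ |A_1\setminus B_2|+|A_2\setminus B_1|\}$. A collection $\mathcal C\subseteq\mathcal Y$ is a $2$-$(n,k,d)$-code if any two distinct elements of $\mathcal C$ have transportation distance at least $d$. Define $$H(n,k,d)=\frac12\cdot\frac{n(n-1)\cdots(n-2k+d)}{\left(k(k-1)\cdots\lceil\frac{d+1}{2}\rceil\right)\left(k(k-1)\cdots\lfloor\frac{d+1}{2}\rfloor\right)}.$$ Logarithms are base 2. *)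

(* Defs.v *)
From mathcomp Require Import all_boot all_order all_algebra.

Set Implicit Arguments.
Unset Strict Implicit.
Unset Printing Implicit Defensive.

(* An unordered pair is encoded as the set of its two members. For 0 < k two
   disjoint k-sets are distinct, so every element of [upairs n k] has exactly
   two members. *)
Definition upairs (n k : nat) : {set {set {set 'I_n}}} :=
  [set [set A.1; A.2] | A : {set 'I_n} * {set 'I_n} &
     [&& #|A.1| == k, #|A.2| == k & [disjoint A.1 & A.2]]].

(* Given on ordered representatives; [tdistCl] and [tdistCr] show that it only
   depends on the unordered pairs {A1, A2} and {B1, B2}. *)
Definition tdist (n : nat) (A1 A2 B1 B2 : {set 'I_n}) : nat :=
  minn (#|A1 :\: B1| + #|A2 :\: B2|) (#|A1 :\: B2| + #|A2 :\: B1|).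

Lemma tdistCl (n : nat) (A1 A2 B1 B2 : {set 'I_n}) :
  tdist A2 A1 B1 B2 = tdist A1 A2 B1 B2.
Proof. by rewrite /tdist minnC addnC [#|A2 :\: B1| + _]addnC. Qed.

Lemma tdistCr (n : nat) (A1 A2 B1 B2 : {set 'I_n}) :
  tdist A1 A2 B2 B1 = tdist A1 A2 B1 B2.
Proof. by rewrite /tdist minnC. Qed.

Definition is_code (n k d : nat) (C : {set {set {set 'I_n}}}) : bool :=
  (C \subset upairs n k) &&
  [forall A1 : {set 'I_n}, forall A2 : {set 'I_n},
   forall B1 : {set 'I_n}, forall B2 : {set 'I_n},
     [&& [set A1; A2] \in C, [set B1; B2] \in C
       & [set A1; A2] != [set B1; B2]] ==> (d <= tdist A1 A2 B1 B2)].

Definition num_codes (n k d : nat) : nat :=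
  #|[set C : {set {set {set 'I_n}}} | is_code k d C]|.

From mathcomp Require Import all_classical all_reals all_analysis.
Import numFieldNormedType.Exports.
Local Open Scope ring_scope.

(* The natural-number subtraction [n - 2 * k] is exact when [2 * k <= n]. *)
Definition H (R : realType) (n k d : nat) : R :=
  2^-1 *
  ((\prod_(n - 2 * k + d <= i < n.+1) i%:R) /
   ((\prod_(uphalf d.+1 <= i < k.+1) i%:R) *
    (\prod_((d.+1)./2 <= i < k.+1) i%:R))).

Definition log2 (R : realType) (x : R) : R := ln x / ln 2.

(* Main.v *)
Require Import Defs.
From mathcomp Require Import all_boot all_order all_algebra.
From mathcomp Require Import all_classical all_reals all_analysis.
From mathcomp Require Import ring lra zify.
Import numFieldNormedType.Exports.
Import Order.TTheory GRing.Theory Num.Theory.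

Set Implicit Arguments.
Unset Strict Implicit.
Unset Printing Implicit Defensive.

Local Open Scope ring_scope.

(* With j = k - t, a pair {A1, A2} contains m = 2 C(k, j)^2 ordered pairs
   (S1, S2) of disjoint j-sets with S1 and S2 in different members; there are
   M = C(n, j) C(n - j, j) such (S1, S2) overall, and H(n, k, 2t+1) = M / m.
   Elements of a (2t+1)-code share no (S1, S2), so codes are independent sets in
   the graph joining pairs that share one, and two distinct pairs share at most
   2 (t / k) m of them.  By double counting, a set of u > (1 + e) H vertices
   therefore contains a vertex A of degree at least (u / H - 1) k / (2t).  Codes
   avoiding A live on u - 1 vertices, and those using A on the non-neighbours of A;
   this recursion (the graph container argument of Kleitman and Winston) bounds
   the base 2 logarithm of the number of codes by
   (1 + e) H + O(H t^3 log^2 n / (e k)), and one takes for e the sequence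
   t / (k / log^2 n)^(1/3), which tends to 0. *)

(** * Counting packings by a container recursion *)

Definition packing (T S : finType) (F : T -> {set S}) (C : {set T}) : bool :=
  [forall A in C, forall B in C, (A != B) ==> [disjoint F A & F B]].

Definition packings (T S : finType) (F : T -> {set S}) (U : {set T}) :=
  [set C : {set T} | (C \subset U) && packing F C].

Definition conflicts (T S : finType) (F : T -> {set S}) (U : {set T}) (A : T) :=
  [set B in U | (B != A) && ~~ [disjoint F A & F B]].

Lemma packing_sub (T S : finType) (F : T -> {set S}) (C D : {set T}) :
  C \subset D -> packing F D -> packing F C.
Proof.
move=> /fintype.subsetP CD /forall_inP pD; apply/forall_inP => A AC.
by apply/forall_inP => B BC; exact: (forall_inP (pD A (CD _ AC)) B (CD _ BC)).
Qed.

Lemma card_packings_le (T S : finType) (F : T -> {set S}) (U : {set T}) :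
  (#|packings F U| <= 2 ^ #|U|)%N.
Proof.
rewrite -card_powerset; apply/subset_leq_card/fintype.subsetP => C.
by rewrite !inE => /andP[].
Qed.

(** Split by whether the packing contains [A]. If it does, its other members avoid the neighbours of
    [A], and [A] can be put back, so that removing it loses no information. *)
Lemma card_packings_rec (T S : finType) (F : T -> {set S}) (U : {set T}) (A : T) :
  A \in U ->
  (#|packings F U| <=
     #|packings F (U :\ A)| + #|packings F ((U :\ A) :\: conflicts F U A)|)%N.
Proof.
move=> AU.
have sub : packings F U \subset packings F (U :\ A) :|:
    [set A |: C | C in packings F ((U :\ A) :\: conflicts F U A)].
  apply/fintype.subsetP => C; rewrite inE => /andP[CU pC].
  have [AC|AC] := boolP (A \in C); last first.
    by rewrite !inE pC finset.subsetD1 CU AC.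
  rewrite inE; apply/orP; right; apply/imsetP; exists (C :\ A); last by rewrite finset.setD1K.
  rewrite inE (packing_sub (finset.subsetDl _ _) pC) andbT.
  apply/fintype.subsetP => B; rewrite !inE => /andP[BA BC].
  have BU := fintype.subsetP CU _ BC.
  rewrite BA BU /= andbT negbK.
  have := forall_inP (forall_inP pC _ AC) _ BC.
  by rewrite eq_sym BA.
apply: leq_trans (subset_leq_card sub) _.
apply: leq_trans (leq_card_setU _ _) _.
by rewrite leq_add2l leq_imset_card.
Qed.

(* Double counting of the triples (A, B, s) with s in F A and F B, with
   Cauchy-Schwarz in the linearised form d^2 >= 2 lam d - lam^2. *)
Lemma conflicts_supersaturation (R : realType) (T S : finType)
    (F : T -> {set S}) (U : {set T}) (W : {set S}) (m c : nat) :
  (0 < #|W|)%N -> (0 < #|U|)%N ->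
  (forall A, A \in U -> F A \subset W) ->
  (forall A, A \in U -> #|F A| = m) ->
  (forall A B, A \in U -> B \in U -> A != B -> (#|F A :&: F B| <= c)%N) ->
  exists2 A, A \in U &
    #|U|%:R / (#|W|%:R / m%:R) * m%:R <= m%:R + c%:R * #|conflicts F U A|%:R :> R.
Proof.
move=> W0 U0 FW Fm Fc.
have W0' : (0 : R) < #|W|%:R by rewrite ltr0n.
(* [lam] is the mean over [W] of [d s], the number of [A] in [U] with [s] in [F A]. *)
pose lam : R := #|U|%:R * m%:R / #|W|%:R.
have lamE : #|U|%:R / (#|W|%:R / m%:R) = lam :> R by rewrite invf_div mulrA.
rewrite lamE.
have [/exists_inP[A AU h]|] := boolP
  [exists A in U, lam * m%:R <= m%:R + c%:R * #|conflicts F U A|%:R].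
  by exists A.
rewrite negb_exists_in => /forall_inP small; exfalso.
pose a A s : R := (s \in F A)%:R.
have cardI A B : A \in U -> #|F A :&: F B|%:R = \sum_(s in W) a A s * a B s.
  move=> AU; rewrite /a -sum1_card natr_sum (eq_bigr (fun s => (s \in F A :&: F B)%:R)).
    rewrite [in RHS](eq_bigr (fun s => (s \in F A :&: F B)%:R)); last first.
      by move=> s _; rewrite inE -natrM mulnb.
    rewrite [in RHS](bigID (fun s => s \in F A :&: F B)) /=.
    rewrite [X in _ + X]big1 ?addr0; last by move=> s /andP[_ /negbTE ->].
    apply: eq_bigl => s; rewrite !inE.
    have := fintype.subsetP (FW _ AU) s.
    by case: (s \in F A) => [/(_ isT) -> //|_]; rewrite /= ?andbF.
  by move=> s ->.
pose d s : R := \sum_(A in U) a A s.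
have sumd : \sum_(s in W) d s = #|U|%:R * m%:R.
  rewrite /d exchange_big /= (eq_bigr (fun=> m%:R)).
    by rewrite sumr_const mulr_natl.
  move=> A AU; rewrite -(Fm _ AU) -[in RHS](finset.setIid (F A)) cardI //.
  by apply: eq_bigr => s _; rewrite /a -natrM mulnb andbb.
have sumd2 : \sum_(s in W) d s ^+ 2 =
    \sum_(A in U) \sum_(B in U) #|F A :&: F B|%:R.
  rewrite (eq_bigr (fun s => \sum_(A in U) \sum_(B in U) a A s * a B s)); last first.
    by move=> s _; rewrite expr2 big_distrlr.
  rewrite exchange_big /=; apply: eq_bigr => A AU.
  by rewrite exchange_big /=; apply: eq_bigr => B _; rewrite cardI.
have low : lam * (#|U|%:R * m%:R) <= \sum_(s in W) d s ^+ 2.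
  have -> : lam * (#|U|%:R * m%:R) = \sum_(s in W) (2 * lam * d s - lam ^+ 2).
    rewrite sumrB -mulr_sumr sumd sumr_const -mulr_natr /lam.
    by field; rewrite gt_eqF.
  apply: ler_sum => s _; have := sqr_ge0 (d s - lam); nra.
(* For fixed [A] the diagonal term is [m], each conflicting [B] contributes at most [c], and every
   other [B] contributes 0. *)
have up : \sum_(A in U) \sum_(B in U) #|F A :&: F B|%:R <=
    \sum_(A in U) (m%:R + c%:R * #|conflicts F U A|%:R) :> R.
  apply: ler_sum => A AU.
  rewrite (bigD1 A) //= finset.setIid Fm // lerD2l.
  rewrite (bigID (fun B => B \in conflicts F U A)) /=.
  rewrite [X in _ + X]big1 ?addr0; last first.
    move=> B /andP[/andP[BU BA]]; rewrite inE BU BA /= negbK -finset.setI_eq0 => /eqP ->.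
    by rewrite cards0.
  rewrite mulr_natr -sumr_const [leRHS](eq_bigl (fun B =>
      ((B \in U) && (B != A)) && (B \in conflicts F U A))); last first.
    by move=> B; rewrite inE; case: (B \in U); case: (B != A).
  apply: ler_sum => B /andP[/andP[BU BA] _].
  by rewrite ler_nat Fc // eq_sym.
have : \sum_(A in U) (m%:R + c%:R * #|conflicts F U A|%:R) < \sum_(A in U) (lam * m%:R) :> R.
  move/card_gt0P: U0 => [A0 A0U].
  apply: ltr_sum; last by move=> A AU; rewrite ltNge small.
  by apply/hasP; exists A0; rewrite ?mem_index_enum.
rewrite [X in _ < X -> _]sumr_const -[X in _ < X -> _]mulr_natl.
move=> h; have := le_lt_trans low; rewrite sumd2 => /(_ _ (le_lt_trans up h)).
by rewrite mulrCA ltxx.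
Qed.

(** Goes through [1 / (1 + x)], since [(1 + x) (1 - x / 2) >= 1] on the unit interval. The gap
    [x / 2] is the room left for the second branch of the recursion. *)
Lemma expRN_le_half (R : realType) (x : R) :
  0 <= x -> x <= 1 -> expR (- x) <= 1 - x / 2.
Proof.
move=> x0 x1; rewrite expRN.
have h := expR_ge1Dx x.
have e0 : 0 < 1 + x by lra.
apply: (@le_trans _ _ (1 + x)^-1); first by rewrite lef_pV2 ?posrE ?expR_gt0.
rewrite -[leLHS]mul1r ler_pdivrMr //; nra.
Qed.

(** The exponent has three sources: the trivial bound [2 ^ u] once [u <= (1 + e) h]; a charge [x]
    for each vertex deleted; and a charge [ln (2 / x)] for each vertex put into the packing. Above
    the threshold, such a choice shrinks [1 + u / h] by a factor of at most [1 - b], where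
    [b = e m / (3 c h)], so about [ln (1 + #|V| / h) / b] choices can occur. *)
Lemma card_packings_bound (R : realType) (T S : finType)
    (F : T -> {set S}) (V : {set T}) (W : {set S}) (m c : nat) (e x : R)
    (h := #|W|%:R / m%:R : R) :
  (0 < #|W|)%N -> (0 < m)%N -> (0 < c)%N ->
  (forall A, A \in V -> F A \subset W) ->
  (forall A, A \in V -> #|F A| = m) ->
  (forall A B, A \in V -> B \in V -> A != B -> (#|F A :&: F B| <= c)%N) ->
  0 < e <= 1 -> 0 < x <= 1 ->
  #|packings F V|%:R <= expR ((1 + e) * h * ln 2 + x * #|V|%:R +
    ln (2 / x) / (e * m%:R / (3 * c%:R * h)) * ln (1 + #|V|%:R / h)).
Proof.
move=> W0 m0 c0 FW Fm Fc /andP[e0 e1] /andP[x0 x1].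
have m0' : (0 : R) < m%:R by rewrite ltr0n.
have c0' : (0 : R) < c%:R by rewrite ltr0n.
have h0 : 0 < h by rewrite divr_gt0 // ltr0n.
set b := e * m%:R / (3 * c%:R * h).
have b0 : 0 < b.
  apply: divr_gt0; first exact: mulr_gt0.
  by apply: mulr_gt0 => //; apply: mulr_gt0.
set p := ln (2 / x) / b.
have lx0 : 0 <= ln (2 / x) by apply: ln_ge0; rewrite ler_pdivlMr //; lra.
have p0 : 0 <= p by rewrite divr_ge0 // ltW.
(* The potential [g u] satisfies [g (u - 1) + g u' <= g u] whenever
   [1 + u' / h <= (1 + u / h) (1 - b)]: the two terms are at most [(1 - x / 2) g u]
   and [x / 2 * g u], the second because [expR (- b * p) = x / 2]. *)
pose g (u : R) := expR ((1 + e) * h * ln 2 + x * u + p * ln (1 + u / h)).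
suff main : forall N (U : {set T}), (#|U| <= N)%N -> U \subset V ->
    #|packings F U|%:R <= g #|U|%:R by exact: (main #|V|).
have u_ge0 (u : nat) : 0 <= u%:R / h by rewrite divr_ge0 // ltW.
have w_gt0 (u : nat) : 0 < 1 + u%:R / h by rewrite ltr_pwDl.
have small (U : {set T}) : #|U|%:R <= (1 + e) * h -> #|packings F U|%:R <= g #|U|%:R.
  move=> Uh; apply: (@le_trans _ _ (2 ^+ #|U|)).
    by rewrite -natrX ler_nat card_packings_le.
  rewrite -[X in X ^+ _](@lnK R 2) ?posrE // -expRM_natl ler_expR.
  rewrite -addrA (@le_trans _ _ ((1 + e) * h * ln 2)) //.
    by rewrite ler_wpM2r // ln_ge0 // ler1n.
  rewrite lerDl addr_ge0 // mulr_ge0 ?(ltW x0) //.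
  by rewrite ln_ge0 // lerDl.
have L0 : 0 <= (1 + e) * h by rewrite mulr_ge0 ?(ltW h0) // addr_ge0 // ltW.
elim=> [|N IH] U UN UV.
  by apply: small; move: UN; rewrite leqn0 => /eqP ->.
have [/small//|big] := leP (#|U|%:R : R) ((1 + e) * h).
have U0 : (0 < #|U|)%N.
  by rewrite -(ltr0n R); exact: le_lt_trans big.
have UVP A : A \in U -> A \in V by exact: (fintype.subsetP UV).
have [|||A AU] := @conflicts_supersaturation R T S F U W m c W0 U0.
- by move=> A /UVP /FW.
- by move=> A /UVP /Fm.
- by move=> A B /UVP AV /UVP; exact: Fc.
rewrite -/h; set dg := #|conflicts F U A| => degA.
have cardU1 : #|U :\ A| = #|U|.-1 by rewrite (cardsD1 A U) AU.
set U2 := (U :\ A) :\: conflicts F U A.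
have U2U : U2 \subset U :\ A by exact: finset.subsetDl.
have cardU2 : (#|U2| + dg <= #|U|)%N.
  rewrite /U2 /dg -(cardsID (conflicts F U A) U) addnC leq_add //.
    apply/subset_leq_card/fintype.subsetP => B BC; rewrite inE BC andbT.
    by move: BC; rewrite inE => /andP[].
  by apply/subset_leq_card/finset.setSD/subsetDl.
have h1 := card_packings_rec F AU; rewrite -(ler_nat R) natrD in h1.
apply: le_trans h1 _.
have IH1 : #|packings F (U :\ A)|%:R <= g (#|U|.-1)%:R.
  rewrite -cardU1; apply: IH; first by rewrite cardU1 -ltnS prednK.
  exact: fintype.subset_trans (finset.subsetDl _ _) UV.
have IH2 : #|packings F U2|%:R <= g #|U2|%:R.
  apply: IH; last exact: fintype.subset_trans (fintype.subset_trans U2U (finset.subsetDl _ _)) UV.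
  rewrite -ltnS; apply: leq_trans UN.
  by rewrite (cardsD1 A U) AU ltnS subset_leq_card.
apply: le_trans (lerD IH1 IH2) _.
pose u : R := #|U|%:R.
have predE : (#|U|.-1)%:R = u - 1 :> R by rewrite /u -subn1 natrB.
have g1 : g (#|U|.-1)%:R <= expR (- x) * g u.
  rewrite -expRD ler_expR predE.
  have : ln (1 + (u - 1) / h) <= ln (1 + u / h).
    rewrite ler_ln ?posrE.
    - by rewrite lerD2l ler_pM2r ?invr_gt0 // gerBl.
    - by rewrite -predE.
    - exact: w_gt0.
  move=> /(ler_wpM2l p0); lra.
have g2 : g #|U2|%:R <= x / 2 * g u.
  rewrite -[x / 2]invf_div -[_^-1](@lnK R) ?posrE ?invr_gt0 ?divr_gt0 //.
  rewrite lnV ?posrE ?divr_gt0 // -expRD ler_expR.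
  have -> : ln (2 / x) = p * b by rewrite /p divfK // gt_eqF.
  have w0 : 0 < 1 + u / h := w_gt0 #|U|.
  have step : 1 + #|U2|%:R / h <= (1 + u / h) * (1 - b).
    have hd : #|U2|%:R + dg%:R <= u by rewrite /u -natrD ler_nat.
    have lam : 1 + e < u / h by rewrite ltr_pdivlMr.
    have dgc : (u / h - 1) * (m%:R / c%:R) <= dg%:R.
      by rewrite mulrA ler_pdivrMr //; move: degA; rewrite -/u; lra.
    have bE : b = e / 3 * (m%:R / c%:R) / h.
      by rewrite /b; field; rewrite !gt_eqF.
    have mc0 : 0 < m%:R / c%:R :> R by rewrite divr_gt0.
    (* The 3 in [b] comes from here: at [u / h = 1 + e] the inequality amounts to [e <= 1], and its
       right side grows faster in [u / h] than its left side. *)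
    have : (1 + u / h) * (e / 3) <= u / h - 1 by nra.
    move=> /(ler_wpM2r (ltW mc0)) hh.
    have := le_trans hh dgc.
    rewrite -(ler_pM2r (x := h^-1)) ?invr_gt0 // => h3.
    have : #|U2|%:R / h + dg%:R / h <= u / h by rewrite -mulrDl ler_pM2r ?invr_gt0.
    move: h3; rewrite bE !mulrA; lra.
  (* Positivity of [1 - b] is read off from [step], whose left side is positive. *)
  have b1 : 0 < 1 - b by rewrite -(pmulr_rgt0 _ w0); exact: lt_le_trans step.
  have lnb : ln (1 - b) <= - b.
    rewrite -[leRHS]expRK ler_ln ?posrE ?expR_gt0 //; have := expR_ge1Dx (- b); lra.
  have : ln (1 + #|U2|%:R / h) <= ln (1 + u / h) - b.
    apply: (@le_trans _ _ (ln ((1 + u / h) * (1 - b)))).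
      by rewrite ler_ln ?posrE // mulr_gt0.
    by rewrite lnM ?posrE //; lra.
  move=> /(ler_wpM2l p0).
  have : x * #|U2|%:R <= x * u.
    by rewrite ler_wpM2l ?(ltW x0) // ler_nat; apply: leq_trans cardU2; rewrite leq_addr.
  lra.
have := expRN_le_half (ltW x0) x1.
have gu0 : 0 < g u by exact: expR_gt0.
move=> /(ler_wpM2r (ltW gu0)).
rewrite -/u; lra.
Qed.

(** * Disjoint pairs of [j]-sets and their incidence with unordered pairs *)

Definition disjoint_pairs (T : finType) (j : nat) : {set {set T} * {set T}} :=
  [set s : {set T} * {set T} | [&& #|s.1| == j, #|s.2| == j & [disjoint s.1 & s.2]]].

Definition draw_pairs (T : finType) (j : nat) (X Y : {set T}) :
    {set {set T} * {set T}} :=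
  finset.setX [set B : {set T} | (B \subset X) && (#|B| == j)]
              [set B : {set T} | (B \subset Y) && (#|B| == j)].

(* These are ordered pairs although [A] is an unordered one, so both [(S1, S2)]
   and [(S2, S1)] are counted. *)
Definition subpairs (T : finType) (j : nat) (A : {set {set T}}) :
    {set {set T} * {set T}} :=
  \bigcup_(X in A) \bigcup_(Y in A | X != Y) draw_pairs j X Y.

Lemma card_draw_pairs (T : finType) (j : nat) (X Y : {set T}) :
  #|draw_pairs j X Y| = ('C(#|X|, j) * 'C(#|Y|, j))%N.
Proof. by rewrite cardsX !cards_draws. Qed.

(** Once the first set is fixed, the second is drawn from its complement. *)
Lemma card_disjoint_pairs (T : finType) (j : nat) :
  #|disjoint_pairs T j| = ('C(#|T|, j) * 'C(#|T| - j, j))%N.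
Proof.
rewrite -sum1_card (eq_bigl (fun s : {set T} * {set T} =>
    (#|s.1| == j) && ((s.2 \subset ~: s.1) && (#|s.2| == j)))); last first.
  move=> s; rewrite inE disjoint_sym finset.disjoints_subset.
  by rewrite [(_ \subset _) && _]andbC.
rewrite -(pair_big_dep (fun X : {set T} => #|X| == j)
  (fun X Y : {set T} => (Y \subset ~: X) && (#|Y| == j)) (fun _ _ => 1%N)) /=.
rewrite (eq_bigr (fun=> 'C(#|T| - j, j))); last first.
  move=> X /eqP Xj; have -> : (#|T| - j = #|~: X|)%N by rewrite -Xj -(cardsC X) addKn.
  by rewrite -cards_draws sum1dep_card.
by rewrite sum_nat_const -card_draws; congr (_ * _)%N; apply: eq_card => B; rewrite !inE.
Qed.

Lemma upairsP (n k : nat) (A : {set {set 'I_n}}) : (0 < k)%N -> A \in upairs n k ->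
  exists X Y, [/\ A = [set X; Y]%SET, #|X| = k, #|Y| = k, [disjoint X & Y] & X != Y].
Proof.
move=> k0 /imsetP[[X Y]]; rewrite inE /= => /and3P[/eqP Xk /eqP Yk XY] ->.
exists X, Y; split=> //; apply/eqP => E; move: XY; rewrite -E -setI_eq0 finset.setIid.
by rewrite -cards_eq0 Xk; case: (k) k0.
Qed.

(** Counts ordered representatives; the factor 2 given away is absorbed later by a power of [n]. *)
Lemma card_upairs_le (n k : nat) :
  (#|upairs n k| <= 'C(n, k) * 'C(n - k, k))%N.
Proof.
rewrite -[X in 'C(X, k)]card_ord -[X in 'C(X - k, k)]card_ord -card_disjoint_pairs.
apply: leq_trans (leq_imset_card _ _) _.
by apply/subset_leq_card/fintype.subsetP => s; rewrite !inE.
Qed.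

Lemma subpairs_set2 (T : finType) (j : nat) (X Y : {set T}) : X != Y ->
  subpairs j [set X; Y]%SET = draw_pairs j X Y :|: draw_pairs j Y X.
Proof.
move=> XY; apply/setP => s; rewrite finset.in_setU; apply/bigcupP/orP.
  move=> [X' X'A /bigcupP[Y' /andP[Y'A ne]]]; move: X'A Y'A ne.
  by rewrite !in_set2 => /orP[]/eqP-> /orP[]/eqP->; rewrite ?eqxx //; [left|right].
case=> sXY.
- exists X; rewrite ?set21 //; apply/bigcupP; exists Y => //.
  by rewrite set22.
- exists Y; rewrite ?set22 //; apply/bigcupP; exists X => //.
  by rewrite set21 eq_sym.
Qed.

(** The two orientations give disjoint families: a common first component would be nonempty, as
    [0 < j], and would lie in both of two disjoint sets. *)
Lemma card_subpairs (n k j : nat) (A : {set {set 'I_n}}) : (0 < j <= k)%N ->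
  A \in upairs n k -> #|subpairs j A| = (2 * 'C(k, j) ^ 2)%N.
Proof.
move=> /andP[j0 jk] /(upairsP (leq_trans j0 jk))[X [Y [-> Xk Yk XY ne]]].
rewrite subpairs_set2 // cardsU !card_draw_pairs Xk Yk.
suff -> : draw_pairs j X Y :&: draw_pairs j Y X = finset.set0.
  by rewrite cards0 subn0 mulnn mul2n addnn.
apply/setP => -[B D]; rewrite !inE /=; apply/negP.
move=> /andP[/andP[/andP[BX /eqP Bj] _] /andP[/andP[BY _] _]].
move: j0; rewrite -Bj card_gt0 => /set0Pn[i iB].
have := fintype.subsetP BX _ iB; move: XY; rewrite finset.disjoints_subset => /fintype.subsetP h /h.
by rewrite inE (fintype.subsetP BY).
Qed.

Lemma subpairs_subset (n k j : nat) (A : {set {set 'I_n}}) : (0 < k)%N ->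
  A \in upairs n k -> subpairs j A \subset disjoint_pairs 'I_n j.
Proof.
move=> k0 /(upairsP k0)[X [Y [-> _ _ XY ne]]]; rewrite subpairs_set2 //.
apply/fintype.subsetP => -[B D]; rewrite !inE /=.
move=> /orP[] /andP[/andP[BX ->] /andP[DY ->]] /=; last rewrite disjoint_sym.
  exact: disjointW XY.
exact: disjointW XY.
Qed.

(** Common draws are draws from [X :&: X'] and [Y :&: Y'], and two distinct [k]-sets share at most
    [k - 1] elements. *)
Lemma draw_pairsI_le (T : finType) (k j : nat) (X Y X' Y' : {set T}) :
  #|X| = k -> #|Y| = k -> #|X'| = k -> #|Y'| = k -> (X != X') || (Y != Y') ->
  (#|draw_pairs j X Y :&: draw_pairs j X' Y'| <= 'C(k.-1, j) * 'C(k, j))%N.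
Proof.
move=> Xk Yk X'k Y'k ne.
have sub : draw_pairs j X Y :&: draw_pairs j X' Y' \subset
    draw_pairs j (X :&: X') (Y :&: Y').
  apply/fintype.subsetP => -[B D]; rewrite !inE /= !finset.subsetI.
  by move=> /andP[/andP[/andP[-> ->] /andP[-> _]] /andP[/andP[-> _] /andP[-> ->]]].
apply: leq_trans (subset_leq_card sub) _; rewrite card_draw_pairs.
have le (P Q : {set T}) : #|P| = k -> (#|P :&: Q| <= k)%N.
  by move=> <-; apply: subset_leq_card; exact: finset.subsetIl.
have lt (P Q : {set T}) : #|P| = k -> #|Q| = k -> P != Q -> (#|P :&: Q| <= k.-1)%N.
  move=> Pk Qk PQ; suff : (#|P :&: Q| < k)%N by case: (k).
  rewrite ltn_neqAle le // andbT; apply: contra PQ => /eqP h.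
  have /eqP E : P :&: Q == P by rewrite eqEcard finset.subsetIl Pk h leqnn.
  by rewrite eqEcard Qk Pk leqnn andbT; exact/finset.setIidPl.
case/orP: ne => ne.
  by rewrite leq_mul // leq_bin2l // ?lt ?le.
by rewrite mulnC leq_mul // leq_bin2l // ?lt ?le.
Qed.

(** Distinct unordered pairs differ in either relative orientation, so [draw_pairsI_le] applies to
    each of the four intersections. For [j = k - t] the bound equals [2 (t / k) m]. *)
Lemma card_subpairsI_le (n k j : nat) (A B : {set {set 'I_n}}) : (0 < k)%N ->
  A \in upairs n k -> B \in upairs n k -> A != B ->
  (#|subpairs j A :&: subpairs j B| <= 4 * ('C(k.-1, j) * 'C(k, j)))%N.
Proof.
move=> k0 /(upairsP k0)[X [Y [-> Xk Yk _ ne]]] /(upairsP k0)[X' [Y' [-> X'k Y'k _ ne']]].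
move=> AB.
have n1 : (X != X') || (Y != Y').
  by rewrite -negb_and; apply: contra AB => /andP[/eqP -> /eqP ->].
have n2 : (X != Y') || (Y != X').
  by rewrite -negb_and; apply: contra AB => /andP[/eqP -> /eqP ->]; rewrite finset.setUC.
rewrite !subpairs_set2 // finset.setIUl !finset.setIUr.
have quarters (a b c d q : nat) : (a <= q -> b <= q -> c <= q -> d <= q ->
    (a + b) + (c + d) <= 4 * q)%N by lia.
apply: leq_trans (leq_card_setU _ _) _.
apply: leq_trans (leq_add (leq_card_setU _ _) (leq_card_setU _ _)) _.
by apply: quarters; apply: draw_pairsI_le; rewrite // orbC.
Qed.

(** A shared [(P, Q)] aligns two members of the code: suitably oriented, both have [P] in the first
    set and [Q] in the second. Each difference then has at most [k - (k - t) = t] elements, and the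
    distance is at most [2 t]. *)
Lemma code_packing (n k t : nat) (C : {set {set {set 'I_n}}}) :
  (t < k)%N -> is_code k (2 * t + 1) C -> packing (@subpairs 'I_n (k - t)) C.
Proof.
move=> tk /andP[/fintype.subsetP CV /forallP dC]; have k0 : (0 < k)%N by exact: leq_trans tk.
apply/forall_inP => A AC; apply/forall_inP => B BC; apply/implyP => AB.
rewrite -setI_eq0; apply/negPn/negP => /set0Pn[[P Q]]; rewrite inE => /andP[sA sB].
have repr E : E \in upairs n k -> (P, Q) \in subpairs (k - t) E ->
    exists X Y, [/\ E = [set X; Y]%SET, #|X| = k, #|Y| = k & (P, Q) \in draw_pairs (k - t) X Y].
  move=> /(upairsP k0)[X [Y [-> Xk Yk XY ne]]]; rewrite subpairs_set2 // inE => /orP[] h.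
    by exists X, Y.
  by exists Y, X; rewrite finset.setUC.
have [X [Y [EA Xk Yk]]] := repr A (CV _ AC) sA.
rewrite !inE /= => /andP[/andP[PX /eqP Pj] /andP[QY /eqP Qj]].
have [X' [Y' [EB X'k Y'k]]] := repr B (CV _ BC) sB.
rewrite !inE /= => /andP[/andP[PX' _] /andP[QY' _]].
move: (dC X) => /forallP/(_ Y)/forallP/(_ X')/forallP/(_ Y'); rewrite -EA -EB AC BC AB /=.
apply/negP; rewrite -ltnNge addn1 ltnS /tdist; apply: leq_trans (geq_minl _ _) _.
have bound (Z Z' S : {set 'I_n}) : #|Z| = k -> #|S| = (k - t)%N -> S \subset Z -> S \subset Z' ->
    (#|Z :\: Z'| <= t)%N.
  move=> Zk Sj SZ SZ'; apply: (@leq_trans #|Z :\: S|).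
    by apply/subset_leq_card/finset.setDS.
  by rewrite cardsD (finset.setIidPr SZ) Zk Sj subKn // ltnW.
by rewrite mul2n -addnn; apply: leq_add; [exact: (bound _ _ P) | exact: (bound _ _ Q)].
Qed.

(** * [H] through binomial coefficients, and its ratio to the number of pairs *)

Lemma bin_mul_bin_fact (n j : nat) : (2 * j <= n)%N ->
  ('C(n, j) * 'C(n - j, j) * (j`! ^ 2 * (n - 2 * j)`!))%N = n`!.
Proof.
move=> jn; rewrite -(@bin_fact n j); last by lia.
rewrite -(@bin_fact (n - j) j); last by lia.
by rewrite (_ : n - j - j = n - 2 * j)%N; [ring | lia].
Qed.

(** Every product is a quotient of factorials. As [d = 2 t + 1] is odd, both roundings of
    [(d + 1) / 2] give [t + 1], and the two products in the denominator agree. *)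
Lemma H_bin (R : realType) (n k t : nat) : (t <= k)%N -> (2 * k <= n)%N ->
  H R n k (2 * t + 1) =
  ('C(n, k - t) * 'C(n - (k - t), k - t))%:R / (2 * 'C(k, k - t) ^ 2)%:R.
Proof.
move=> tk kn; rewrite /H.
have -> : uphalf (2 * t + 1).+1 = t.+1 by lia.
have -> : ((2 * t + 1).+1)./2 = t.+1 by lia.
have e1 : (n - 2 * k + (2 * t + 1) = (n - 2 * (k - t)).+1)%N by lia.
have p1 : (\prod_(n - 2 * k + (2 * t + 1) <= i < n.+1) i%:R) = n`!%:R / (n - 2 * (k - t))`!%:R :> R.
  rewrite e1 (@fact_split n (n - 2 * (k - t)) (leq_subr _ _)) natrM natr_prod.
  by rewrite mulrC mulKf // pnatr_eq0 -lt0n fact_gt0.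
have p2 : (\prod_(t.+1 <= i < k.+1) i%:R) = k`!%:R / t`!%:R :> R.
  rewrite (@fact_split k t) // natrM natr_prod.
  by rewrite mulrC mulKf // pnatr_eq0 -lt0n fact_gt0.
rewrite p1 p2 -(@bin_mul_bin_fact n (k - t)); last by lia.
have := @bin_fact k (k - t) (leq_subr _ _); rewrite subKn // => <-.
have nz m : m`!%:R != 0 :> R by rewrite pnatr_eq0 -lt0n fact_gt0.
have cz : 'C(k, k - t)%:R != 0 :> R by rewrite pnatr_eq0 -lt0n bin_gt0 leq_subr.
rewrite !(natrM, natrX); field.
by rewrite !nz cz.
Qed.

Lemma ffact_le_expn (n m : nat) : (n ^_ m <= n ^ m)%N.
Proof.
elim: m n => [|m IH] n; first by rewrite ffactn0.
rewrite ffactnS expnS leq_mul // (leq_trans (IH _)) //.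
case: m {IH} => [|m]; first by rewrite !expn0.
by rewrite leq_exp2r // leq_pred.
Qed.

(** With [j = k - t], the ratio of ['C(n, k) * 'C(n - k, k)] to [H] is
    [2 (n - 2j)! / ((n - 2k)! t!^2)], which is at most [2 n^(2t)]; the 2 is at most [n^t]. *)
Lemma card_upairs_le_H (R : realType) (n k t : nat) :
    (1 < n)%N -> (0 < t <= k)%N -> (2 * k <= n)%N ->
  #|upairs n k|%:R <= n%:R ^+ (3 * t) * H R n k (2 * t + 1).
Proof.
move=> n1 /andP[t0 tk] kn; rewrite H_bin //.
have cz : (0 < 'C(k, k - t))%N by rewrite bin_gt0 leq_subr.
rewrite mulrA ler_pdivlMr ?ltr0n ?muln_gt0 ?expn_gt0 ?cz //.
rewrite -natrX -!natrM ler_nat.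
set j := (k - t)%N; have kE : (k = j + t)%N by rewrite /j subnK.
have fg m : (0 < m`!)%N by exact: fact_gt0.
(* Multiplying by this common denominator turns all binomial coefficients into factorials without
   leaving the natural numbers. *)
have Pg : (0 < k`! ^ 2 * (n - 2 * k)`! * (t`! ^ 2 * j`! ^ 2) * (n - 2 * j)`!)%N.
  by rewrite !muln_gt0 ?expn_gt0 ?fg.
apply: leq_trans (leq_mul (card_upairs_le n k) (leqnn _)) _.
rewrite -(leq_pmul2r Pg).
have Ek := bin_mul_bin_fact kn.
have Ej : ('C(n, j) * 'C(n - j, j) * (j`! ^ 2 * (n - 2 * j)`!))%N = n`!.
  by apply: bin_mul_bin_fact; rewrite /j; lia.
have Ec := @bin_fact k j (leq_subr _ _).
have kj : (k - j = t)%N by rewrite [in LHS]kE addKn.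
rewrite kj in Ec.
have Ef : ((n - 2 * j) ^_ (2 * t) * (n - 2 * k)`!)%N = (n - 2 * j)`!.
  have -> : (n - 2 * k = n - 2 * j - 2 * t)%N by lia.
  by apply: ffact_fact; lia.
have bd : (2 * (n - 2 * j) ^_ (2 * t) <= n ^ (3 * t))%N.
  have -> : (3 * t = t + 2 * t)%N by lia.
  rewrite expnD leq_mul //.
    by apply: leq_trans n1 _; rewrite -[leqLHS]expn1 leq_pexp2l //; lia.
  apply: leq_trans (ffact_le_expn _ _) _.
  by rewrite leq_exp2r ?muln_gt0 ?leq_subr.
move: Ek Ej Ec Ef bd.
set a := 'C(n, k); set b := 'C(n - k, k); set c := 'C(n, j); set d := 'C(n - j, j).
set q := 'C(k, j); set f := _ ^_ _; set w := (n - 2 * k)`!; set z := (n - 2 * j)`!.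
move=> Ek Ej Ec Ef bd.
have -> : (a * b * (2 * q ^ 2) * (k`! ^ 2 * w * (t`! ^ 2 * j`! ^ 2) * z) =
  2 * (a * b * (k`! ^ 2 * w)) * (q * (j`! * t`!)) ^ 2 * z)%N by ring.
have -> : (n ^ (3 * t) * (c * d) * (k`! ^ 2 * w * (t`! ^ 2 * j`! ^ 2) * z) =
  n ^ (3 * t) * (c * d * (j`! ^ 2 * z)) * k`! ^ 2 * w * t`! ^ 2)%N by ring.
rewrite Ek Ej Ec -Ef.
have -> : (2 * n`! * k`! ^ 2 * (f * w) = 2 * f * (n`! * k`! ^ 2 * w))%N by ring.
have -> : (n ^ (3 * t) * n`! * k`! ^ 2 * w * t`! ^ 2 =
   n ^ (3 * t) * (n`! * k`! ^ 2 * w * t`! ^ 2))%N by ring.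
apply: leq_mul => //.
by rewrite leq_pmulr // expn_gt0 fg.
Qed.

(** * The packing bound applied to codes *)

Lemma num_codes_packings (n k t : nat) : (t < k)%N ->
  (num_codes n k (2 * t + 1) <=
     #|packings (@subpairs 'I_n (k - t)) (upairs n k)|)%N.
Proof.
move=> tk; apply/subset_leq_card/fintype.subsetP => C; rewrite !inE => cC.
by rewrite (code_packing tk cC) andbT; case/andP: cC.
Qed.

(** The ratio [c / m = 2 t / k] makes the factor [3 c h / (e m)] of the packing bound equal to
    [6 t h / (e k)]. *)
Lemma num_codes_bound (R : realType) (n k t : nat) (e x : R)
    (h := H R n k (2 * t + 1)) :
  (0 < t < k)%N -> (2 * k <= n)%N -> 0 < e <= 1 -> 0 < x <= 1 ->
  (num_codes n k (2 * t + 1))%:R <= expR ((1 + e) * h * ln 2 +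
    x * #|upairs n k|%:R +
    6 * t%:R * h / (e * k%:R) * ln (2 / x) * ln (1 + #|upairs n k|%:R / h)).
Proof.
move=> /andP[t0 tk] kn e01 x01.
have k0 : (0 < k)%N by exact: leq_trans tk.
pose m := (2 * 'C(k, k - t) ^ 2)%N.
pose c := (4 * ('C(k.-1, k - t) * 'C(k, k - t)))%N.
have cz : (0 < 'C(k, k - t))%N by rewrite bin_gt0 leq_subr.
have cz' : (0 < 'C(k.-1, k - t))%N by rewrite bin_gt0; lia.
have W0 : (0 < #|disjoint_pairs 'I_n (k - t)|)%N.
  by rewrite card_disjoint_pairs card_ord muln_gt0 !bin_gt0; lia.
have ck : (c * k = 2 * t * m)%N.
  (* After complementation this is the absorption identity [k 'C(k - 1, t - 1) = t 'C(k, t)]. *)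
  have e1 : (k * 'C(k.-1, k - t) = t * 'C(k, k - t))%N.
    rewrite -bin_sub; last by lia.
    rewrite -[in RHS]bin_sub ?leq_subr //.
    have -> : (k.-1 - (k - t) = t.-1)%N by lia.
    by rewrite subKn ?(ltnW tk) // mul_bin_diag prednK.
  rewrite /c /m; transitivity (4 * 'C(k, k - t) * (k * 'C(k.-1, k - t)))%N; first by ring.
  by rewrite e1; ring.
have hE : #|disjoint_pairs 'I_n (k - t)|%:R / m%:R = h.
  by rewrite /h H_bin ?(ltnW tk) // card_disjoint_pairs card_ord.
apply: (@le_trans _ _ #|packings (@subpairs 'I_n (k - t)) (upairs n k)|%:R).
  by rewrite ler_nat num_codes_packings.
have := @card_packings_bound R _ _ (@subpairs 'I_n (k - t)) (upairs n k)
  (disjoint_pairs 'I_n (k - t)) m c e x W0.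
rewrite hE => main; apply: le_trans (main _ _ _ _ _ e01 x01) _.
- by rewrite /m muln_gt0 expn_gt0 cz.
- by rewrite /c !muln_gt0 cz cz'.
- by move=> A; exact: subpairs_subset.
- by move=> A; apply: card_subpairs; rewrite subn_gt0 tk leq_subr.
- by move=> A B; exact: card_subpairsI_le.
have m0 : (0 : R) < m%:R by rewrite ltr0n muln_gt0 expn_gt0 cz.
have kR : (0 : R) < k%:R by rewrite ltr0n.
have h0 : 0 < h by rewrite -hE; apply: divr_gt0 => //; rewrite ltr0n.
have e0 : 0 < e by case/andP: e01.
have c0 : (0 : R) < c%:R by rewrite ltr0n !muln_gt0 cz cz'.
have tR : (0 : R) < t%:R by rewrite ltr0n.
have cE : c%:R = 2 * t%:R * m%:R / k%:R :> R.
  have kn0 : k%:R != 0 :> R by rewrite gt_eqF.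
  by rewrite -!natrM -ck natrM mulfK.
rewrite le_eqVlt; apply/orP; left; apply/eqP; congr expR; congr (_ + _).
rewrite cE; field.
by rewrite !gt_eqF.
Qed.

(** * Choice of the parameters for fixed [n] *)

Lemma ln2_ge_half (R : realType) : 2^-1 <= ln 2 :> R.
Proof.
have := expR_ge1Dx (- ln 2 : R); rewrite expRN lnK ?posrE // => h.
have : 1 - 2^-1 = 2^-1 :> R by field.
lra.
Qed.

Lemma ln2_le1 (R : realType) : ln 2 <= 1 :> R.
Proof.
rewrite -[leRHS]expRK ler_ln ?posrE ?expR_gt0 //.
by have := expR_ge1Dx (1 : R); lra.
Qed.

Lemma H_gt0 (R : realType) (n k d : nat) : (0 < d)%N -> 0 < H R n k d.
Proof.
move=> d0.
have pos a b : (0 < a)%N -> 0 < \prod_(a <= i < b) i%:R :> R.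
  move=> a0; rewrite big_nat_cond; apply: prodr_gt0 => i /andP[/andP[ai _] _].
  by rewrite ltr0n (leq_trans a0).
rewrite /H mulr_gt0 ?invr_gt0 // divr_gt0 ?mulr_gt0 ?pos //; lia.
Qed.

(** Witnessed by the empty code, so that logarithms of the count may be taken. *)
Lemma num_codes_gt0 (n k d : nat) : (0 < num_codes n k d)%N.
Proof.
apply/card_gt0P; exists finset.set0; rewrite inE /is_code finset.sub0set /=.
by do 4![apply/forallP => ?]; rewrite inE.
Qed.

(** Take [x = e / n^(3t)]. The second term is then at most [e h <= 2 e h ln 2], and the two
    logarithms are at most [5 t ln n] and [4 t ln n]. The relation for [e ^+ 3] turns the resulting
    third term into [120 h (e ln 2)^2]. In total [123 = 1 + 2 + 120]. *)
Lemma num_codes_le_expR (R : realType) (n k t : nat) (e : R)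
    (h := H R n k (2 * t + 1)) :
  (1 < n)%N -> (0 < t < k)%N -> (2 * k <= n)%N -> 0 < e <= 1 ->
  e ^+ 3 = t%:R ^+ 3 * log2 (n%:R : R) ^+ 2 / k%:R ->
  (num_codes n k (2 * t + 1))%:R <= expR (h * (1 + 123 * e) * ln 2).
Proof.
move=> n1 /andP[t0 tk] kn /andP[e0 e1] e3.
have kn1 : (k <= n)%N by lia.
have t5 : (3 * t + 2 <= 5 * t)%N by lia.
have t4 : (3 * t + 1 <= 4 * t)%N by lia.
have k0 : (0 < k)%N by exact: leq_trans tk.
have kR : (0 : R) < k%:R by rewrite ltr0n.
have tR : (1 : R) <= t%:R by rewrite ler1n.
have nR : (2 : R) <= n%:R by rewrite ler_nat.
have h0 : 0 < h by apply: H_gt0; rewrite addn1.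
have l2 := ln2_ge_half R; have l2' := ln2_le1 R.
have l20 : 0 < ln 2 :> R by lra.
set l := ln (n%:R : R).
have lE : l = log2 (n%:R : R) * ln 2 by rewrite /log2 divfK // gt_eqF.
have L1 : 1 <= log2 (n%:R : R).
  by rewrite /log2 ler_pdivlMr // mul1r ler_ln ?posrE //; lra.
have l0 : 0 <= l by rewrite lE; apply: mulr_ge0; lra.
(* Indeed [e >= e^3 >= 1 / k >= 1 / n]. *)
have en : 1 <= e * n%:R.
  have t3 : 1 <= t%:R ^+ 3 :> R by rewrite exprn_ege1.
  have L2 : 1 <= log2 (n%:R : R) ^+ 2 by rewrite exprn_ege1.
  have : k%:R^-1 <= e ^+ 3.
    by rewrite e3 -[leLHS]mul1r ler_pM2r ?invr_gt0 //; nra.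
  have : e ^+ 3 <= e by rewrite exprS ger_pMr // exprn_ile1 // ltW.
  move=> a b; have := le_trans b a.
  rewrite -[leLHS]mul1r ler_pdivrMr // => /le_trans; apply.
  by rewrite ler_pM2l // ler_nat.
pose D : R := n%:R ^+ (3 * t).
have D1 : 1 <= D by rewrite exprn_ege1 // ler1n ltnW.
have D0 : 0 < D by lra.
have VD : #|upairs n k|%:R <= D * h.
  by apply: card_upairs_le_H => //; rewrite t0 ltnW.
have npow i j : (i <= j)%N -> n%:R ^+ i <= n%:R ^+ j :> R.
  by move=> ij; rewrite ler_weXn2l // ler1n ltnW.
have lnpow (y : R) i : 0 < y -> y <= n%:R ^+ (i * t) -> ln y <= i%:R * t%:R * l.
  move=> y0 yn; rewrite -natrM mulr_natl -lnXn; last by lra.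
  by rewrite ler_ln ?posrE // (lt_le_trans y0 yn).
have x01 : 0 < e / D <= 1.
  by rewrite divr_gt0 //= ler_pdivrMr // mul1r; lra.
have e01 : 0 < e <= 1 by rewrite e0.
have := @num_codes_bound R n k t e (e / D); rewrite t0 tk => /(_ isT kn e01 x01).
move=> /le_trans; apply; rewrite ler_expR -/h.
have term2 : e / D * #|upairs n k|%:R <= e * h.
  by rewrite -mulrA ler_pM2l // mulrC ler_pdivrMr // mulrC.
(* By [en] and [t >= 1], [2 D / e <= 2 n D <= n^(3t + 2) <= n^(5t)]. *)
have lnx_le : ln (2 / (e / D)) <= 5 * t%:R * l.
  apply: lnpow; first by rewrite !divr_gt0.
  apply: (@le_trans _ _ (n%:R ^+ (3 * t + 2))); last exact: npow.
  rewrite invf_div mulrA ler_pdivrMr // exprD -/D expr2.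
  have := mulr_ge0 (ltW D0) (le_trans _ nR : 0 <= n%:R); nra.
have lnV_le : ln (1 + #|upairs n k|%:R / h) <= 4 * t%:R * l.
  apply: lnpow; first by rewrite ltr_pwDl // divr_ge0 // ltW.
  apply: (@le_trans _ _ (n%:R ^+ (3 * t + 1))); last exact: npow.
  have : #|upairs n k|%:R / h <= D by rewrite ler_pdivrMr.
  by rewrite exprD -/D expr1; nra.
have lnn1 : 0 <= ln (2 / (e / D)).
  case/andP: x01 => x0 x1; apply: ln_ge0; rewrite ler_pdivlMr //; lra.
have lnn2 : 0 <= ln (1 + #|upairs n k|%:R / h).
  by rewrite ln_ge0 // lerDl divr_ge0 // ltW.
have term3 : 6 * t%:R * h / (e * k%:R) * ln (2 / (e / D)) *
    ln (1 + #|upairs n k|%:R / h) <= 120 * h * e * ln 2.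
  apply: (@le_trans _ _ (6 * t%:R * h / (e * k%:R) * (5 * t%:R * l) * (4 * t%:R * l))).
    have c0 : 0 <= 6 * t%:R * h / (e * k%:R).
      by apply: divr_ge0; apply: mulr_ge0; lra.
    by apply: ler_pM => //; [apply: mulr_ge0 | apply: ler_wpM2l].
  have -> : 6 * t%:R * h / (e * k%:R) * (5 * t%:R * l) * (4 * t%:R * l) =
      120 * h * (ln 2) ^+ 2 * e ^+ 2.
    have -> : e ^+ 2 = e ^+ 3 / e by field; rewrite gt_eqF.
    by rewrite e3 lE; field; rewrite !gt_eqF.
  have : ln 2 ^+ 2 * e ^+ 2 <= ln 2 * e :> R.
    by rewrite -exprMn expr2 ger_pMr ?mulr_gt0 // mulr_ile1 // ltW.
  have h120 : 0 <= 120 * h by lra.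
  by move=> /(ler_wpM2l h120); rewrite !mulrA; lra.
have eh : 0 < e * h by exact: mulr_gt0.
have : e * h <= 2 * (e * h) * ln 2 by nra.
lra.
Qed.

(** * Passage to the limit *)

Local Open Scope classical_set_scope.
Local Open Scope ring_scope.

Theorem theorem5p5 (R : realType) (k t : nat -> nat)
    (k_le : forall n : nat, (2 * k n <= n)%N)
    (k_gt0 : \forall n \near \oo, (0 < k n)%N)
    (t_gt0 : forall n : nat, (0 < t n)%N)
    (t_small :
      (fun n : nat =>
         (t n)%:R / (((k n)%:R / log2 (n%:R : R) ^+ 2) `^ (3%:R)^-1) : R)
        @ \oo --> (0 : R)) :
  exists eps : nat -> R,
    (eps @ \oo --> (0 : R)) /\
    forall n : nat,
      (num_codes n (k n) (2 * t n + 1))%:R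
        <= 2 `^ (H R n (k n) (2 * t n + 1) * (1 + eps n)) :> R.
Proof.
have l20 : 0 < ln 2 :> R by apply: lt_le_trans (ln2_ge_half R).
have h0 n : 0 < H R n (k n) (2 * t n + 1) by apply: H_gt0; rewrite addn1.
have hl n : 0 < H R n (k n) (2 * t n + 1) * ln 2 by exact: mulr_gt0.
have N0 n : (0 : R) < (num_codes n (k n) (2 * t n + 1))%:R.
  by rewrite ltr0n num_codes_gt0.
(* [v n] is the error for which the bound is an equality, so its truncation at 0 works for every
   [n], including those with [k n = 0]. Only the limit calls on the estimate, and the truncation
   supplies the lower side of the squeeze. *)
pose v n := ln (num_codes n (k n) (2 * t n + 1))%:R /
  (H R n (k n) (2 * t n + 1) * ln 2) - 1 : R.
exists (fun n => Num.max 0 (v n)); split; last first.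
  move=> n; rewrite -ler_ln ?posrE ?powR_gt0 // ln_powR.
  rewrite [leRHS]mulrAC [leRHS]mulrC -ler_pdivrMr // -lerBlDl.
  by rewrite le_max lexx orbT.
set r := (fun n : nat => _ : R) in t_small.
apply: (@squeeze_cvgr _ _ _ _ (fun=> 0) (fun n => 123 * r n)); last first.
- by rewrite -[X in _ --> X](mulr0 123); apply: cvgMr.
- exact: cvg_cst.
near=> n.
rewrite le_max lexx /= ge_max.
have n1 : (1 < n)%N by near: n; exists 2%N.
have kn0 : (0 < k n)%N by near: n.
have kR : (0 : R) < (k n)%:R by rewrite ltr0n.
have L1 : 1 <= log2 (n%:R : R).
  by rewrite /log2 ler_pdivlMr // mul1r ler_ln ?posrE ?ltr0n ?ler_nat // ltnW.
have L0 : 0 < log2 (n%:R : R) by lra.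
set y := ((k n)%:R / log2 (n%:R : R) ^+ 2) `^ (3%:R)^-1.
have a0 : 0 < (k n)%:R / log2 (n%:R : R) ^+ 2 by rewrite divr_gt0 // exprn_gt0.
have y0 : 0 < y by exact: powR_gt0.
have y3 : y ^+ 3 = (k n)%:R / log2 (n%:R : R) ^+ 2.
  by rewrite -powR_mulrn ?ltW // -powRrM mulVf // powRr1 // ltW.
have rE : r n = (t n)%:R / y by [].
have r0 : 0 < r n by rewrite rE divr_gt0 // ltr0n.
(* Any constant below 1 serves: [r n] becomes admissible as [e], and [r n ^+ 3 < 1]. *)
have r1 : r n <= 2^-1.
  rewrite ltW // -[r n]gtr0_norm //; near: n.
  by apply: (cvgr0_norm_lt _ t_small 2^-1); rewrite invr_gt0.
have r3 : r n ^+ 3 = (t n)%:R ^+ 3 * log2 (n%:R : R) ^+ 2 / (k n)%:R.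
  by rewrite rE expr_div_n y3; field; rewrite !gt_eqF.
(* From [r n ^+ 3 < 1] one gets [t <= t^3 log^2 n < k]. *)
have tk : (t n < k n)%N.
  rewrite -(ltr_nat R).
  have r31 : r n ^+ 3 < 1 by rewrite exprn_ilt1 //; lra.
  move: r31; rewrite r3 ltr_pdivrMr // mul1r; apply: le_lt_trans.
  have t1 : 1 <= (t n)%:R :> R by rewrite ler1n.
  have t3 : (t n)%:R <= (t n)%:R ^+ 3 :> R by rewrite ler_eXnr.
  have L2 : 1 <= log2 (n%:R : R) ^+ 2 by rewrite exprn_ege1.
  nra.
have r01 : 0 < r n <= 1 by rewrite r0 /=; lra.
have tk' : (0 < t n < k n)%N by rewrite t_gt0.
have := num_codes_le_expR n1 tk' (k_le n) r01 r3.
rewrite -ler_ln ?posrE ?expR_gt0 // expRK => main.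
apply/andP; split; first by apply: mulr_ge0; lra.
rewrite lerBlDl ler_pdivrMr //.
by apply: le_trans main _; rewrite mulrAC mulrC.
Unshelve. all: by end_near.
Qed.
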